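(* For any $\zeta,\delta,\epsilon \in (0,1)$ and $h \in \mathbb{N}$, there exist $j = j(\zeta,\delta,h,\epsilon) \in \mathbb{N}$ and $n_0 = n_0(\zeta,\delta,h,\epsilon) \in \mathbb{N}$ such that the following holds. Let $n \geq n_0$, let $\zeta n < k < (1-\zeta)n$, and let $\mathcal{F} \subset \binom{[n]}{k}$. Then there exist a set $J \subset [n]$ with $|J| \leq j$ and a family $\mathcal{G} \subset \mathcal{P}(J)$ such that: (1) $\mu(\mathcal{F} \setminus \langle \mathcal{G} \rangle) < \epsilon$; (2) for each $B \in \mathcal{G}$, the family $\mathcal{F}_J^B$ is $(\delta,h)$-slice-quasirandom and satisfies $\mu(\mathcal{F}_J^B) > \frac{\epsilon}{2}$.
   Context: $[n]=\{1,\dots,n\}$, $\mathcal{P}(X)$ is the power set of $X$, and $\binom{X}{k}$ is the family of $k$-element subsets of $X$. For a family $\mathcal{A}\subset\binom{X}{k}$ ($X$ a finite set), $\mu(\mathcal{A}) := |\mathcal{A}|/\binom{|X|}{k}$. For $\mathcal{A}\subset\binom{X}{k}$ and $B\subset J\subset X$, the slice is $\mathcal{A}_J^B := \{S\setminus B : S\in\mathcal{A},\ S\cap J=B\}$, regarded as a subfamily of $\binom{X\setminus J}{k-|B|}$, so $\mu(\mathcal{A}_J^B)=|\mathcal{A}_J^B|/\binom{|X|-|J|}{k-|B|}$. For $\mathcal{G}\subset\mathcal{P}(J)$ with $J\subset[n]$, $\langle\mathcal{G}\rangle := \{S\in\binom{[n]}{k}: S\cap J\in\mathcal{G}\}$ is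 the $J$-junta generated by $\mathcal{G}$. For $\delta>0$ and $h\in\mathbb{N}$, a family $\mathcal{A}\subset\binom{X}{k}$ is $(\delta,h)$-slice-quasirandom if for any $J\subset X$ with $|J|\le h$ and any $B\subset J$, we have $|\mu(\mathcal{A}_J^B)-\mu(\mathcal{A})|<\delta$. *)

(* Defs.v *)
From mathcomp Require Import all_boot all_order all_algebra.
From mathcomp Require Import reals.

Set Implicit Arguments.
Unset Strict Implicit.
Unset Printing Implicit Defensive.

Import Order.TTheory GRing.Theory Num.Theory.

Local Open Scope ring_scope.

(* The ground set [X] and the uniformity [k] of a family are explicit         *)
(* arguments throughout, since taking a slice changes both: if                *)
(* [A \subset layer X k], then [slice A J B] is regarded as a subfamily of    *)
(* [layer (X :\: J) (k - #|B|)].                                              *)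
Definition layer (T : finType) (X : {set T}) (k : nat) : {set {set T}} :=
  [set S : {set T} | (S \subset X) && (#|S| == k)].

(* By [x / 0 = 0], this is 0 if [layer X k] is empty.                         *)
Definition mu (R : realType) (T : finType) (X : {set T}) (k : nat)
    (A : {set {set T}}) : R :=
  #|A|%:R / 'C(#|X|, k)%:R.

Definition slice (T : finType) (A : {set {set T}}) (J B : {set T}) :
    {set {set T}} :=
  [set S :\: B | S in A & S :&: J == B].

Definition junta (T : finType) (X : {set T}) (k : nat) (J : {set T})
    (G : {set {set T}}) : {set {set T}} :=
  [set S in layer X k | S :&: J \in G].

(* [k - #|B|] is truncated, harmlessly: if [k < #|B|], then the slice of a    *)
(* [k]-uniform family is empty and has measure 0.                             *)
Definition slice_quasirandom (R : realType) (T : finType) (delta : R) (h : nat)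
    (X : {set T}) (k : nat) (A : {set {set T}}) : Prop :=
  forall J B : {set T}, J \subset X -> (#|J| <= h)%N -> B \subset J ->
    `|mu R (X :\: J) (k - #|B|) (slice A J B) - mu R X k A| < delta.

(* Main.v *)
(** Energy increment. For a set [J] of coordinates, the energy is the sum over
    the layer of the squared density of the slice of [F] containing each point;
    it is at most the size of the layer. If the slices over [J] that are not
    quasirandom carry at least [eps / 2] of the measure, adjoin to [J] a witness
    of irregularity for each of them. As [k / n] stays away from 0 and 1, every
    witness occupies at least a fraction [(zeta / 2) ^+ h] of its slice, so the
    energy grows by a constant proportion of the layer, and this happens boundedly
    often. Afterwards, [G] collects the quasirandom slices of density more than
    [eps / 2]; the rest of [F] has measure less than [eps / 2 + eps / 2]. *)

Require Import Defs.
From mathcomp Require Import all_boot all_order all_algebra.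
From mathcomp Require Import ring lra.
From mathcomp Require Import reals.

Import Order.TTheory GRing.Theory Num.Theory.

Local Open Scope ring_scope.

Set Implicit Arguments.
Unset Strict Implicit.

(** * Fibers and conditional densities *)

(** A slice before [B] is deleted: fibers over different coordinate sets stay inside the same layer,
    so they can be nested and partitioned. *)
Definition fiber (T : finType) (A : {set {set T}}) (J B : {set T}) :
    {set {set T}} :=
  [set S in A | S :&: J == B].

Lemma fiberS (T : finType) (A A' : {set {set T}}) (J B : {set T}) :
  A \subset A' -> fiber A J B \subset fiber A' J B.
Proof.
move=> sAA'; apply/subsetP => S; rewrite !inE => /andP[SA ->].
by rewrite (subsetP sAA').
Qed.

Lemma fiber_refine (T : finType) (A : {set {set T}}) (J K B D : {set T}) :
  J \subset K -> D :&: J = B -> fiber A K D \subset fiber A J B.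
Proof.
move=> sJK <-; apply/subsetP => S; rewrite !inE => /andP[-> /eqP<-] /=.
by rewrite -setIA (setIidPr sJK).
Qed.

Lemma sum_card_fiber (T : finType) (A : {set {set T}}) (J : {set T}) :
  (\sum_(B in powerset J) #|fiber A J B|)%N = #|A|.
Proof.
rewrite -sum1_card.
rewrite [RHS](partition_big (fun S => S :&: J) (mem (powerset J))) /=.
  apply: eq_bigr => B _; rewrite -sum1_card; apply: eq_bigl => S.
  by rewrite inE.
by move=> S _; rewrite inE subsetIr.
Qed.

Definition dens (R : realType) (T : finType) (L F : {set {set T}})
    (J B : {set T}) : R :=
  #|fiber F J B|%:R / #|fiber L J B|%:R.

Lemma densM (R : realType) (T : finType) (L F : {set {set T}})
    (J B : {set T}) :
  F \subset L -> dens R L F J B * #|fiber L J B|%:R = #|fiber F J B|%:R.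
Proof.
move=> sFL; rewrite /dens.
(* An empty fiber of [L] has density 0 by convention; the fiber of [F] is then empty too, so the
   identity survives. *)
have [L0|L0] := eqVneq #|fiber L J B| 0%N; last by rewrite divfK ?pnatr_eq0.
have := subset_leq_card (fiberS J B sFL).
by rewrite L0 leqn0 => /eqP->; rewrite mulr0.
Qed.

Lemma dens_ge0 (R : realType) (T : finType) (L F : {set {set T}})
    (J B : {set T}) : 0 <= dens R L F J B.
Proof. by rewrite divr_ge0 ?ler0n. Qed.

Lemma dens_le1 (R : realType) (T : finType) (L F : {set {set T}})
    (J B : {set T}) :
  F \subset L -> dens R L F J B <= 1.
Proof.
move=> sFL; rewrite /dens.
have [->|L0] := posnP #|fiber L J B|; first by rewrite invr0 mulr0.
by rewrite ler_pdivrMr ?ltr0n// mul1r ler_nat subset_leq_card ?fiberS.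
Qed.

(** Tower property: the fibers over [K] partition each fiber over [J], and the density summed over
    one of them counts its members of [F]. *)
Lemma sum_dens (R : realType) (T : finType) (L F : {set {set T}})
    (J K B : {set T}) :
  F \subset L -> J \subset K ->
  \sum_(S in fiber L J B) dens R L F K (S :&: K) = #|fiber F J B|%:R.
Proof.
move=> sFL sJK.
rewrite (partition_big (fun S => S :&: K) (fun D => D :&: J == B)) /=; last first.
  by move=> S; rewrite inE => /andP[_]; rewrite -setIA (setIidPr sJK).
rewrite -sum1_card natr_sum.
rewrite [RHS](partition_big (fun S => S :&: K) (fun D => D :&: J == B)) /=; last first.
  by move=> S; rewrite inE => /andP[_]; rewrite -setIA (setIidPr sJK).
have fib A D : D :&: J == B ->
    (fun S => (S \in fiber A J B) && (S :&: K == D)) =1 (fun S => S \in fiber A K D).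
  move=> /eqP DJ S /=; apply/andP/idP => [[]|SD].
    by rewrite !inE => /andP[-> _] ->.
  split; first by rewrite (subsetP (fiber_refine A sJK DJ)).
  by move: SD; rewrite inE => /andP[].
apply: eq_bigr => D DJ.
rewrite (eq_bigl _ _ (fib L D DJ)) [RHS](eq_bigl _ _ (fib F D DJ)).
rewrite sumr_const -(densM R K D sFL) mulr_natr.
rewrite (eq_bigr (fun=> dens R L F K D)) ?sumr_const //.
by move=> S; rewrite inE => /andP[_ /eqP->].
Qed.

(** * Energy and its increment *)

Definition energy (R : realType) (T : finType) (L F : {set {set T}})
    (J : {set T}) : R :=
  \sum_(S in L) dens R L F J (S :&: J) ^+ 2.

Lemma energy_ge0 (R : realType) (T : finType) (L F : {set {set T}})
    (J : {set T}) : 0 <= energy R L F J.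
Proof. by apply: sumr_ge0 => S _; exact: sqr_ge0. Qed.

Lemma energy_le (R : realType) (T : finType) (L F : {set {set T}})
    (J : {set T}) :
  F \subset L -> energy R L F J <= #|L|%:R.
Proof.
move=> sFL; rewrite -sum1_card natr_sum; apply: ler_sum => S _.
by rewrite exprn_ile1 ?dens_ge0 ?dens_le1.
Qed.

Lemma sum_fibers (R : realType) (T : finType) (L : {set {set T}})
    (J : {set T}) (f : {set T} -> R) :
  \sum_(S in L) f S = \sum_(B in powerset J) \sum_(S in fiber L J B) f S.
Proof.
rewrite (partition_big (fun S => S :&: J) (mem (powerset J))) /=.
  by apply: eq_bigr => B _; apply: eq_bigl => S; rewrite inE.
by move=> S _; rewrite inE subsetIr.
Qed.

(* Pythagoras: [dens J] is the conditional expectation of [dens K].           *)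
Lemma energyD (R : realType) (T : finType) (L F : {set {set T}})
    (J K : {set T}) :
  F \subset L -> J \subset K ->
  energy R L F K = energy R L F J +
    \sum_(S in L) (dens R L F K (S :&: K) - dens R L F J (S :&: J)) ^+ 2.
Proof.
move=> sFL sJK.
(* On a fiber over [J] the factor [dens J] is constant and comes out of the sum; what remains is
   evaluated by [sum_dens] on both sides. *)
have cross : \sum_(S in L) dens R L F K (S :&: K) * dens R L F J (S :&: J) =
             energy R L F J.
  rewrite /energy !(sum_fibers L J); apply: eq_bigr => B _.
  rewrite (eq_bigr (fun S => dens R L F K (S :&: K) * dens R L F J B)); last first.
    by move=> S; rewrite inE => /andP[_ /eqP->].
  rewrite [RHS](eq_bigr (fun S => dens R L F J (S :&: J) * dens R L F J B)).
    by rewrite -!mulr_suml !sum_dens.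
  by move=> S; rewrite inE => /andP[_ /eqP->]; rewrite expr2.
under [X in _ + X]eq_bigr do rewrite sqrrB.
rewrite big_split sumrB /= sumrMnl cross -/(energy R L F K) -/(energy R L F J).
ring.
Qed.

(** Convexity of the square, as [dens K] has mean [dens J] on the fiber. It ensures that a deviation
    seen on a witness is not lost when further coordinates are adjoined. *)
Lemma dens_jensen (R : realType) (T : finType) (L F : {set {set T}})
    (J K B : {set T}) (c : R) :
  F \subset L -> J \subset K ->
  #|fiber L J B|%:R * (dens R L F J B - c) ^+ 2 <=
  \sum_(S in fiber L J B) (dens R L F K (S :&: K) - c) ^+ 2.
Proof.
move=> sFL sJK; set t := dens R L F J B - c.
(* The tangent line of the square at [t] lies below the square and has mean [t ^+ 2] over the
   fiber. *)
have -> : #|fiber L J B|%:R * t ^+ 2 =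
    \sum_(S in fiber L J B)
      (2 * t * (dens R L F K (S :&: K) - c) - t ^+ 2).
  rewrite sumrB -mulr_sumr sumrB sum_dens// !sumr_const -(densM R J B sFL).
  by rewrite -(mulr_natr c) -(mulr_natr (t ^+ 2)) /t; ring.
by apply: ler_sum => S _; have := sqr_ge0 (dens R L F K (S :&: K) - c - t); nra.
Qed.

(** [N B] and [D B] are the enlarged coordinate set and the trace of a witness for [B]. By
    Pythagoras the gain is a sum of squares; it is kept only on the witness fibers, where
    [dens_jensen] yields at least [delta ^+ 2] per point on average. *)
Lemma energy_increment (R : realType) (T : finType) (L F : {set {set T}})
    (J K : {set T}) (Q : {set {set T}}) (N D : {set T} -> {set T})
    (c delta : R) :
  F \subset L -> J \subset K -> Q \subset powerset J -> 0 <= delta ->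
  (forall B, B \in Q ->
    [/\ J \subset N B, N B \subset K, D B :&: J = B,
        delta <= `|dens R L F (N B) (D B) - dens R L F J B|
      & c * #|fiber L J B|%:R <= #|fiber L (N B) (D B)|%:R]) ->
  energy R L F J + c * delta ^+ 2 * (\sum_(B in Q) #|fiber L J B|)%:R <=
  energy R L F K.
Proof.
move=> sFL sJK sQ d0 H; rewrite (energyD R sFL sJK) lerD2l.
rewrite (sum_fibers L J) [leRHS](big_setID Q) /= (setIidPr sQ).
rewrite natr_sum mulr_sumr -[leLHS]addr0 lerD//; last first.
  by apply: sumr_ge0 => B _; apply: sumr_ge0 => S _; exact: sqr_ge0.
apply: ler_sum => B BQ; have [sJN sNK DJ dev big] := H B BQ.
rewrite (eq_bigr (fun S => (dens R L F K (S :&: K) - dens R L F J B) ^+ 2));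
  last by move=> S; rewrite inE => /andP[_ /eqP->].
rewrite [leRHS](big_setID (fiber L (N B) (D B))) /=.
rewrite (setIidPr (fiber_refine L sJN DJ)) -[leLHS]addr0 lerD//;
  last by apply: sumr_ge0 => S _; exact: sqr_ge0.
apply: le_trans (dens_jensen _ _ sFL sNK).
rewrite mulrAC.
apply: (@le_trans _ _ (#|fiber L (N B) (D B)|%:R * delta ^+ 2)).
  by rewrite ler_wpM2r ?sqr_ge0.
rewrite ler_wpM2l ?ler0n// -[leRHS]real_normK ?num_real//.
by rewrite lerXn2r ?nnegrE.
Qed.

(** * Ratios of binomial coefficients *)

(** The quotient of the two binomials is [r / m]. *)
Lemma bin_predl_ge (R : realType) (c : R) (m r : nat) :
  0 <= c -> c * m%:R + 1 <= r%:R -> (r <= m)%N ->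
  c * 'C(m, r)%:R <= 'C(m.-1, r.-1)%:R.
Proof.
case: m => [|m]; case: r => [|r] //= c0 cr rm; first by nra.
  by rewrite mulr0n in cr; have := ler0n R m; nra.
have m0 : 0 < m.+1%:R :> R by rewrite ltr0n.
rewrite -(ler_pM2l m0) -natrM mul_bin_diag natrM mulrA ler_wpM2r ?ler0n//.
by rewrite mulrC; lra.
Qed.

(** Here the quotient is [(m - r) / m]. *)
Lemma bin_predr_ge (R : realType) (c : R) (m r : nat) :
  0 <= c -> c * m%:R + 1 + r%:R <= m%:R ->
  c * 'C(m, r)%:R <= 'C(m.-1, r)%:R.
Proof.
case: m => [|m] /= c0 cr; first by have := ler0n R r; nra.
have m0 : 0 < m.+1%:R :> R by rewrite ltr0n.
have rm : (r <= m.+1)%N.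
  by rewrite -(ler_nat R); have := mulr_ge0 c0 (ltW m0); lra.
rewrite -(ler_pM2l m0) -natrM mul_bin_down natrM mulrA ler_wpM2r ?ler0n//.
by rewrite natrB// mulrC; lra.
Qed.

(** Think of [a] forced members and [b] forced non-members, fixed one at a time, each costing a
    factor of at least [c]. The two margins persist because [c * m] only decreases along the way. *)
Lemma binom_ratio (R : realType) (c : R) (m r a b : nat) :
  0 <= c -> c * m%:R + a%:R <= r%:R -> c * m%:R + b%:R + r%:R <= m%:R ->
  c ^+ (a + b) * 'C(m, r)%:R <= 'C(m - (a + b), r - a)%:R.
Proof.
move=> c0; elim: a m r => [|a IHa] m r; last first.
  rewrite addSn -natr1 => car cbm.
  have cm : 0 <= c * m%:R by rewrite mulr_ge0.
  have rm : (r <= m)%N by rewrite -(ler_nat R); have := ler0n R b; lra.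
  have r0 : (0 < r)%N by rewrite -(ltr_nat R); have := ler0n R a; lra.
  have mE : m%:R = m.-1%:R + 1 :> R.
    by rewrite natr1 prednK// (leq_trans r0).
  have rE : r%:R = r.-1%:R + 1 :> R by rewrite natr1 prednK.
  rewrite exprSr -mulrA.
  have := @bin_predl_ge R c m r c0 _ rm; have /[swap] /[apply] : c * m%:R + 1 <= r%:R.
    by have := ler0n R a; lra.
  move=> /(ler_wpM2l (exprn_ge0 (a + b) c0)) /le_trans; apply.
  have -> : (m - (a + b).+1 = m.-1 - (a + b))%N by rewrite -subn1 -subnDA.
  have -> : (r - a.+1 = r.-1 - a)%N by rewrite -subn1 -subnDA.
  by apply: IHa; nra.
(* Only non-members are left to fix, so [r] stays put. *)
rewrite add0n subn0 mulr0n addr0.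
elim: b m => [|b IHb] m; first by rewrite subn0 mul1r.
rewrite -natr1 => cr cbm.
have cm : 0 <= c * m%:R by rewrite mulr_ge0.
have m0 : (0 < m)%N.
  by rewrite -(ltr_nat R); have := ler0n R b; have := ler0n R r; lra.
have mE : m%:R = m.-1%:R + 1 :> R by rewrite natr1 prednK.
rewrite exprSr -mulrA.
have := @bin_predr_ge R c m r c0; have /[swap] /[apply] : c * m%:R + 1 + r%:R <= m%:R.
  by have := ler0n R b; lra.
move=> /(ler_wpM2l (exprn_ge0 b c0)) /le_trans; apply.
have -> : (m - b.+1 = m.-1 - b)%N by rewrite -subn1 -subnDA.
by apply: IHb; nra.
Qed.

(** * Slices, fibers and layers *)

(** Deleting [B] is injective on the fiber, whose members all contain [B]. *)
Lemma card_slice (T : finType) (A : {set {set T}}) (J B : {set T}) :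
  #|slice A J B| = #|fiber A J B|.
Proof.
rewrite /slice card_in_imset => [|S S']; first by apply: eq_card => S; rewrite !inE.
rewrite !inE => /andP[_ /eqP SB] /andP[_ /eqP S'B] eqD.
by rewrite -(setID S B) -(setID S' B) eqD -SB setIA setIid SB -S'B setIA setIid.
Qed.

Lemma card_layer (T : finType) (X : {set T}) (k : nat) :
  #|layer X k| = 'C(#|X|, k).
Proof. by rewrite -cards_draws; apply: eq_card => S; rewrite !inE. Qed.

(** Adding [B] back inverts the deletion. If [k < #|B|], the left side would be empty, but
    truncation would leave the empty set on the right. *)
Lemma slice_layer (T : finType) (J B : {set T}) (k : nat) :
  B \subset J -> (#|B| <= k)%N ->
  slice (layer [set: T] k) J B = layer ([set: T] :\: J) (k - #|B|).
Proof.
move=> sBJ Bk; apply/setP => S; apply/imsetP/idP => [[S' + ->]|].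
  rewrite !inE subsetT /= => /andP[/eqP cS' /eqP S'J].
  rewrite -S'J setDIr setDv set0U setSD ?subsetT//=.
  by rewrite cardsD cS'.
rewrite !inE => /andP[sS /eqP cS].
have SJ0 : S :&: J = set0.
  apply/eqP; rewrite setI_eq0 disjoint_sym disjoints_subset.
  by rewrite -subsetC (subset_trans sS)// setTD.
have SB0 : S :&: B = set0.
  by apply/eqP; rewrite -subset0 -SJ0 setIS.
exists (S :|: B); last by rewrite setDUl setDv setU0 (setDidPl _)// -setI_eq0 SB0.
rewrite !inE subsetT /= setIUl SJ0 set0U (setIidPl sBJ) eqxx andbT.
by rewrite cardsU SB0 cards0 subn0 cS subnK.
Qed.

Lemma card_fiber_layer (T : finType) (J B : {set T}) (k : nat) :
  B \subset J -> (#|B| <= k)%N ->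
  #|fiber (layer [set: T] k) J B| = 'C(#|T| - #|J|, k - #|B|).
Proof.
move=> sBJ Bk; rewrite -card_slice slice_layer// card_layer.
by rewrite setTD (cardsCs (~: J)) setCK.
Qed.

(** Bridge from the measures in the theorem to the densities of the energy argument. *)
Lemma mu_slice (R : realType) (T : finType) (F : {set {set T}})
    (J B : {set T}) (k : nat) :
  B \subset J -> (#|B| <= k)%N ->
  mu R ([set: T] :\: J) (k - #|B|) (slice F J B) =
  dens R (layer [set: T] k) F J B.
Proof.
move=> sBJ Bk; rewrite /mu /dens card_fiber_layer// card_slice.
by rewrite setTD (cardsCs (~: J)) setCK.
Qed.

Lemma slice_slice (T : finType) (F : {set {set T}}) (J B K D : {set T}) :
  B \subset J -> D \subset K -> K \subset [set: T] :\: J ->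
  slice (slice F J B) K D = slice F (J :|: K) (B :|: D).
Proof.
move=> sBJ sDK; rewrite setTD subsetC => sKJ.
have BK0 : B :&: K = set0.
  by apply/eqP; rewrite setI_eq0 disjoints_subset (subset_trans sBJ).
have DJ0 : D :&: J = set0.
  by apply/eqP; rewrite setI_eq0 disjoints_subset (subset_trans sDK)// subsetC.
have eqK S : (S :\: B) :&: K = S :&: K.
  rewrite setIDAC; apply/setDidPl; rewrite -setI_eq0 -setIA [K :&: B]setIC.
  by rewrite BK0 setI0.
(* [J] and [K] are disjoint, so a trace on their union amounts to a trace on each. *)
have eqJK S : (S :&: J == B) && (S :&: K == D) = (S :&: (J :|: K) == B :|: D).
  apply/andP/eqP => [[/eqP<- /eqP<-]|eqS]; first by rewrite setIUr.
  split; apply/eqP.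
    have /= := congr1 (fun X : {set T} => X :&: J) eqS.
    by rewrite -setIA (setIidPr (subsetUl _ _)) setIUl DJ0 setU0 (setIidPl sBJ).
  have /= := congr1 (fun X : {set T} => X :&: K) eqS.
  by rewrite -setIA (setIidPr (subsetUr _ _)) setIUl BK0 set0U (setIidPl sDK).
apply/setP => S; apply/imsetP/imsetP => [[S1 + ->]|[S0 + ->]].
  rewrite inE => /andP[/imsetP[S0 + ->]].
  rewrite inE eqK => /andP[S0F S0J] S0K.
  by exists S0; rewrite ?setDDl// inE S0F -eqJK S0J.
rewrite inE -eqJK => /and3P[S0F S0J S0K].
exists (S0 :\: B); last by rewrite setDDl.
by rewrite inE eqK S0K andbT; apply/imsetP; exists S0; rewrite // inE S0F.
Qed.

(** * Irregular slices and the iteration *)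

Lemma card_bigcup_le (I T : finType) (P : pred I) (f : I -> {set T}) :
  (#|\bigcup_(i | P i) f i| <= \sum_(i | P i) #|f i|)%N.
Proof.
elim/big_rec2: _ => [|i n A _ le]; first by rewrite cards0.
by apply: leq_trans (leq_card_setU _ _).1 _; rewrite leq_add2l.
Qed.

(** A pair [(P, D)] refuting quasirandomness of the slice at [B], phrased by densities over
    [J :|: P] and made boolean so that [pick] can select one. *)
Definition irregularity (R : realType) (T : finType) (delta : R) (h : nat)
    (L F : {set {set T}}) (J B : {set T}) : pred ({set T} * {set T}) :=
  fun p => [&& p.1 \subset [set: T] :\: J, (#|p.1| <= h)%N, p.2 \subset p.1 &
    delta <= `|dens R L F (J :|: p.1) (B :|: p.2) - dens R L F J B|].

Definition irregular (R : realType) (T : finType) (delta : R) (h : nat)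
    (L F : {set {set T}}) (J : {set T}) : {set {set T}} :=
  [set B in powerset J | [exists p, irregularity delta h L F J B p]].

Lemma card_fiber_ratio (R : realType) (T : finType) (c : R) (h k : nat)
    (J B P D : {set T}) :
  0 <= c <= 1 ->
  c * #|T|%:R + #|J|%:R + h%:R <= k%:R ->
  c * #|T|%:R + #|J|%:R + h%:R + k%:R <= #|T|%:R ->
  B \subset J -> P \subset [set: T] :\: J -> (#|P| <= h)%N -> D \subset P ->
  c ^+ h * #|fiber (layer [set: T] k) J B|%:R <=
  #|fiber (layer [set: T] k) (J :|: P) (B :|: D)|%:R.
Proof.
move=> /andP[c0 c1] ck ckn sBJ sPJ Ph sDP.
have cT : 0 <= c * #|T|%:R by rewrite mulr_ge0.
have BJ := subset_leq_card sBJ; have DP := subset_leq_card sDP.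
have JPk : (#|J| + #|P| <= k)%N.
  by rewrite -(ler_nat R) natrD; move: Ph; rewrite -(ler_nat R); lra.
have JT : (#|J| <= #|T|)%N by exact: max_card.
have JP0 : J :&: P = set0.
  by apply/eqP; rewrite setI_eq0 disjoint_sym disjoints_subset -setTD.
have BD0 : B :&: D = set0 by apply/eqP; rewrite -subset0 -JP0 setISS.
have cJP : #|J :|: P| = (#|J| + #|P|)%N by rewrite cardsU JP0 cards0 subn0.
have cBD : #|B :|: D| = (#|B| + #|D|)%N by rewrite cardsU BD0 cards0 subn0.
have Bk : (#|B| <= k)%N by rewrite (leq_trans BJ)// (leq_trans _ JPk)// leq_addr.
have BDk : (#|B :|: D| <= k)%N by rewrite cBD (leq_trans _ JPk)// leq_add.
rewrite !card_fiber_layer ?setUSS// cJP cBD !subnDA.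
(* As [c <= 1], the exponent [h] may be lowered to [#|P|], which then splits into the members [D]
   and the non-members [P :\: D]. *)
apply: (@le_trans _ _ (c ^+ #|P| * 'C(#|T| - #|J|, k - #|B|)%:R)).
  by rewrite ler_wpM2r ?ler0n// ler_wiXn2l.
have {1 2}-> : #|P| = (#|D| + (#|P| - #|D|))%N by rewrite subnKC.
move: Ph BJ DP; rewrite -!(ler_nat R) => Ph BJ DP.
have J0 := ler0n R #|J|; have B0 := ler0n R #|B|; have D0 := ler0n R #|D|.
apply: binom_ratio => //; rewrite !natrB -?(ler_nat R)//; nra.
Qed.

(** At most [2 ^ #|J|] slices are irregular and each witness brings at most [h] new coordinates,
    whence the size of [K]. *)
Lemma regularity_step (R : realType) (T : finType) (c delta : R) (h k : nat)
    (F : {set {set T}}) (J : {set T}) :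
  let L := layer [set: T] k in
  F \subset L -> 0 <= delta -> 0 <= c <= 1 ->
  c * #|T|%:R + #|J|%:R + h%:R <= k%:R ->
  c * #|T|%:R + #|J|%:R + h%:R + k%:R <= #|T|%:R ->
  exists2 K : {set T}, (#|K| <= #|J| + 2 ^ #|J| * h)%N &
    energy R L F J + c ^+ h * delta ^+ 2 *
      (\sum_(B in irregular delta h L F J) #|fiber L J B|)%:R <=
    energy R L F K.
Proof.
move=> L sFL d0 c01 ck ckn; set Q := irregular _ _ _ _ _.
(* The default pair is never reached for [B] in [Q]. *)
pose w B := odflt (set0, set0) [pick p | irregularity delta h L F J B p].
have wP B : B \in Q -> irregularity delta h L F J B (w B).
  rewrite inE => /andP[_ /existsP[p Hp]]; rewrite /w.
  by case: pickP => [//|/(_ p)]; rewrite Hp.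
have sQ : Q \subset powerset J.
  by apply/subsetP => B; rewrite inE => /andP[].
pose K := J :|: \bigcup_(B in Q) (w B).1.
exists K.
  apply: leq_trans (leq_card_setU _ _).1 _; rewrite leq_add2l.
  apply: leq_trans (card_bigcup_le _ _) _.
  apply: (@leq_trans (\sum_(B in Q) h)).
    by apply: leq_sum => B /wP/and4P[].
  by rewrite sum_nat_const leq_mul2r -card_powerset subset_leq_card ?orbT.
apply: (@energy_increment _ _ _ _ _ _ _
  (fun B => J :|: (w B).1) (fun B => B :|: (w B).2)) => //.
  exact: subsetUl.
move=> B BQ; have /and4P[sP Ph sD dev] := wP B BQ.
have sBJ : B \subset J by move: (subsetP sQ B BQ); rewrite inE.
split; rewrite ?subsetUl//; first by rewrite setUS//; exact: (bigcup_sup B BQ).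
- rewrite setIUl (setIidPl sBJ) (_ : (w B).2 :&: J = set0) ?setU0//.
  apply/eqP; rewrite setI_eq0 disjoints_subset (subset_trans sD)//.
  by rewrite -setTD.
- exact: card_fiber_ratio.
Qed.

(** After [t] rounds either some round has stopped with little irregular mass, or each has gained
    energy; [energy_le] excludes the latter for large [t]. *)
Lemma regularity (R : realType) (T : finType) (c delta theta : R) (h k t : nat)
    (F : {set {set T}}) :
  let L := layer [set: T] k in
  let a s := iter s (fun m => m + 2 ^ m * h)%N 0%N in
  F \subset L -> 0 <= delta -> 0 <= c <= 1 ->
  c * #|T|%:R + (a t)%:R + h%:R <= k%:R ->
  c * #|T|%:R + (a t)%:R + h%:R + k%:R <= #|T|%:R ->
  exists2 J : {set T}, (#|J| <= a t)%N &
    (\sum_(B in irregular delta h L F J) #|fiber L J B|)%:R <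
      theta * #|L|%:R \/
    t%:R * (c ^+ h * delta ^+ 2 * theta) * #|L|%:R <= energy R L F J.
Proof.
move=> L a sFL d0 c01; elim: t => [|t IH] ck ckn.
  exists set0; first by rewrite cards0.
  by right; rewrite !mul0r energy_ge0.
(* As [a] grows, the room assumed for [t.+1] rounds suffices for [t]. *)
have aS : (a t <= a t.+1)%N by rewrite /a iterS leq_addr.
have aSR : (a t)%:R <= (a t.+1)%:R :> R by rewrite ler_nat.
have [||J Ja [small|big]] := IH; [by lra|by lra| |].
  by exists J; [exact: leq_trans aS|left].
have [small|large] :=
  ltP (\sum_(B in irregular delta h L F J) #|fiber L J B|)%:R (theta * #|L|%:R).
  by exists J; [exact: leq_trans aS|left].
have JaR : #|J|%:R <= (a t)%:R :> R by rewrite ler_nat.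
have [||K cK inc] := @regularity_step R T c delta h k F J sFL d0 c01;
  [by lra|by lra|].
exists K.
  by rewrite (leq_trans cK)// /a iterS leq_add// leq_mul2r leq_exp2l// Ja orbT.
right; apply: le_trans inc; rewrite -natr1.
have := ler_wpM2l (mulr_ge0 (exprn_ge0 h (andP c01).1) (sqr_ge0 delta)) large.
by rewrite mulrDl mul1r mulrDl => ?; apply: lerD => //; rewrite -mulrA.
Qed.

(** * From a regular partition to the junta *)

(** Fibers in [Q] are bounded by the whole layer fiber, sparse ones by [eta] times it; a fiber over
    [B] in [G] lies inside the junta and leaves nothing. *)
Lemma card_outside_junta (R : realType) (T : finType) (k : nat) (eta : R)
    (F Q : {set {set T}}) (J : {set T}) :
  let L := layer [set: T] k in
  let G := [set B in powerset J | (B \notin Q) && (eta < dens R L F J B)] in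
  F \subset L -> Q \subset powerset J -> 0 <= eta ->
  #|F :\: junta [set: T] k J G|%:R <=
  (\sum_(B in Q) #|fiber L J B|)%:R + eta * #|L|%:R.
Proof.
move=> L G sFL sQ eta0.
rewrite -(sum_card_fiber (F :\: _) J) -(sum_card_fiber L J) !natr_sum mulr_sumr.
rewrite [leLHS](big_setID Q) [X in _ <= _ + X](big_setID Q) /= (setIidPr sQ) addrA.
apply: lerD.
  rewrite -[leLHS]addr0 lerD ?sumr_ge0//; last by move=> B _; rewrite mulr_ge0.
  apply: ler_sum => B _; rewrite ler_nat subset_leq_card// fiberS//.
  exact: subset_trans (subsetDl _ _) sFL.
apply: ler_sum => B; rewrite inE => /andP[BQ BJ].
have [le|gt] := leP (dens R L F J B) eta.
  apply: (@le_trans _ _ #|fiber F J B|%:R).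
    by rewrite ler_nat subset_leq_card// fiberS// subsetDl.
  by rewrite -(densM R J B sFL) ler_wpM2r.
suff -> : fiber (F :\: junta [set: T] k J G) J B = set0.
  by rewrite cards0 mulr_ge0.
apply/setP => S; rewrite !inE.
apply/negP => /andP[/andP[+ SF] /eqP SB].
have := subsetP sFL _ SF; rewrite inE => /andP[-> ->].
by move: BJ; rewrite SB BQ gt powersetE => ->.
Qed.

(** A slice of a slice is a slice over [J :|: P]. The bound on [#|J| + h] keeps [#|B :|: D|] at most
    [k], so [mu_slice] applies at both levels. *)
Lemma regular_slice_quasirandom (R : realType) (T : finType) (delta : R)
    (h k : nat) (F : {set {set T}}) (J B : {set T}) :
  B \subset J -> (#|J| + h <= k)%N ->
  B \notin irregular delta h (layer [set: T] k) F J ->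
  slice_quasirandom delta h ([set: T] :\: J) (k - #|B|) (slice F J B).
Proof.
move=> sBJ Jhk; rewrite inE powersetE sBJ /= => /existsPn reg P D sPJ Ph sDP.
have := reg (P, D); rewrite /irregularity /= sPJ Ph sDP /= -ltNge.
have BJ := subset_leq_card sBJ; have DP := subset_leq_card sDP.
have BD0 : B :&: D = set0.
  apply/eqP; rewrite setI_eq0 disjoint_sym disjoints_subset.
  rewrite (subset_trans sDP)// (subset_trans sPJ)// setTD.
  by rewrite setCS.
have cBD : #|B :|: D| = (#|B| + #|D|)%N by rewrite cardsU BD0 cards0 subn0.
have Bk : (#|B| <= k)%N by rewrite (leq_trans BJ)// (leq_trans _ Jhk)// leq_addr.
have BDk : (#|B :|: D| <= k)%N.
  by rewrite cBD (leq_trans _ Jhk)// leq_add// (leq_trans DP).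
by rewrite slice_slice// setDDl -subnDA -cBD !mu_slice// setUSS.
Qed.

Unset Implicit Arguments.
Set Strict Implicit.

Theorem theorem1p7 (R : realType) (zeta delta eps : R) (h : nat)
    (hzeta : 0 < zeta < 1) (hdelta : 0 < delta < 1) (heps : 0 < eps < 1) :
  exists j n0 : nat,
    forall (n k : nat) (F : {set {set 'I_n}}),
      (n0 <= n)%N ->
      zeta * n%:R < k%:R < (1 - zeta) * n%:R ->
      F \subset layer [set: 'I_n] k ->
      exists (J : {set 'I_n}) (G : {set {set 'I_n}}),
        [/\ (#|J| <= j)%N,
            G \subset powerset J,
            mu R [set: 'I_n] k (F :\: junta [set: 'I_n] k J G) < eps
          & forall B : {set 'I_n}, B \in G ->
              slice_quasirandom delta h ([set: 'I_n] :\: J) (k - #|B|)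
                (slice F J B) /\
              eps / 2 < mu R ([set: 'I_n] :\: J) (k - #|B|) (slice F J B)].
Proof.
have /andP[z0 z1] := hzeta; have /andP[d0 d1] := hdelta.
have /andP[e0 e1] := heps.
(* One half of [zeta] is the ratio [c]; the other half absorbs [j + h] once [n >= n0]. *)
pose c := zeta / 2; have c0 : 0 < c by rewrite divr_gt0.
have c01 : 0 <= c <= 1 by rewrite /c; lra.
pose gamma := c ^+ h * delta ^+ 2 * (eps / 2).
have gamma0 : 0 < gamma by rewrite !mulr_gt0 ?exprn_gt0 ?invr_gt0.
(* More than [gamma^-1] rounds of gain [gamma] would push the energy above the size of the layer. *)
pose t := Num.bound gamma^-1.
pose j := iter t (fun m => m + 2 ^ m * h)%N 0%N.
pose n0 := Num.bound ((j + h)%:R / c).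
exists j, n0 => n k F n0n /andP[zk kz] sFL.
have nbig : j%:R + h%:R <= c * n%:R.
  rewrite -natrD -ler_pdivrMl// mulrC.
  apply: (@le_trans _ _ n0%:R); last by rewrite ler_nat.
  by apply/ltW/archi_boundP; rewrite divr_ge0// ltW.
have zE : zeta = c + c by exact: splitr.
have kn : (k <= n)%N by rewrite -(ler_nat R); have := ler0n R n; nra.
have L0 : 0 < #|layer [set: 'I_n] k|%:R :> R.
  by rewrite ltr0n card_layer cardsT card_ord bin_gt0.
have [||J Jj [small|big]] :=
  @regularity R 'I_n c delta (eps / 2) h k t F sFL (ltW d0) c01;
  rewrite ?card_ord -/j; [by nra|by nra| |]; last first.
  have := le_trans big (energy_le R J sFL).
  rewrite -/gamma -[leRHS]mul1r ler_pM2r// leNgt.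
  by rewrite -ltr_pdivrMr// div1r archi_boundP// invr_ge0 ltW.
have JjR : #|J|%:R <= j%:R :> R by rewrite ler_nat.
have Jhk : (#|J| + h <= k)%N.
  by rewrite -(ler_nat R) natrD; have := ler0n R n; nra.
set Q := irregular _ _ _ _ _ in small.
exists J, [set B in powerset J |
  (B \notin Q) && (eps / 2 < dens R (layer [set: 'I_n] k) F J B)]; split => //.
- by apply/subsetP => B; rewrite inE => /andP[].
- rewrite /mu -card_layer ltr_pdivrMr//.
  have sQ : Q \subset powerset J.
    by apply/subsetP => B; rewrite inE => /andP[].
  apply: le_lt_trans (card_outside_junta sFL sQ _) _.
    by rewrite divr_ge0 ?ltW.
  (* One [eps / 2] pays for the irregular slices, the other for the sparse ones. *)
  by rewrite [X in _ < X * _]splitr mulrDl ltrD2r.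
- move=> B; rewrite inE powersetE => /and3P[sBJ BQ dB]; split.
    exact: regular_slice_quasirandom.
  rewrite mu_slice// (leq_trans (subset_leq_card sBJ))// (leq_trans _ Jhk)//.
  exact: leq_addr.
Qed.
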